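(* Let $n\ge1$ and $d\ge1$. Every polynomial of degree $d$ in $\boldsymbol{x}\in\mathbb{R}^n$, denoted $p_d(\boldsymbol{x})$, can be written as $$p_d(\boldsymbol{x})=\sum_{i=1}^nx_i\,p_{d-1}^i(\boldsymbol{x})+\sum_{i=1}^n(1-x_i)\,q_{d-1}^i(\boldsymbol{x}),$$ where $p_{d-1}^i(\boldsymbol{x})$ and $q_{d-1}^i(\boldsymbol{x})$, $i=1,\dots,n$, are polynomials of degree $d-1$ that are convex on $[0,1]^n$.
   Context: Polynomials have real coefficients. ''Polynomial of degree $d-1$'' for the $p_{d-1}^i,q_{d-1}^i$ means a polynomial of degree at most $d-1$. The feasible region of the underlying optimization problem is assumed to be contained in $[0,1]^n$. *)

(* Defs.v *)
From mathcomp Require Import all_boot all_order all_algebra.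
From mathcomp Require Import classical_sets reals convex.
From mathcomp Require Import mpoly.

Set Implicit Arguments.
Unset Strict Implicit.
Unset Printing Implicit Defensive.

Import GRing.Theory Num.Theory.

Local Open Scope classical_set_scope.
Local Open Scope ring_scope.

(* [msize p] is one plus the total degree of [p] (and 0 for [p = 0]), so the
   zero polynomial has degree at most [k] for every [k]. *)
Definition degree_le (R : realType) (n k : nat) (p : {mpoly R[n]}) : bool :=
  (msize p <= k.+1)%N.

Definition unit_cube (R : realType) (n : nat) : set 'rV[R]_n :=
  [set x | forall i : 'I_n, 0 <= x 0 i <= 1].

Definition mpoly_fun (R : realType) (n : nat) (p : {mpoly R[n]}) :
    'rV[R]_n -> R := fun x => p.@[fun i => x 0 i].

Definition convex_on_unit_cube (R : realType) (n : nat)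
    (p : {mpoly R[n]}) : Prop :=
  convex_function (@unit_cube R n) (mpoly_fun p).

(* Main.v *)
Require Import Defs.
From mathcomp Require Import all_boot all_order all_algebra.
From mathcomp Require Import boolp classical_sets interval_inference reals convex.
From mathcomp Require Import mpoly ring lra.

Import Order.TTheory GRing.Theory Num.Theory.

Local Open Scope ring_scope.

(** Splitting each monomial of positive degree by one of its variables gives
    [p = c + \sum_i 'X_i * a i] with [c] constant and [a i] of degree at most
    [d - 1]; since [1 = 'X_i + (1 - 'X_i)], the constant can be shared out as
    [c / n] in each of the [2 n] cofactors.  This is a representation of the
    required shape, except for convexity.

    It is convexified without changing its value.  Let
    [s = \sum_j 'X_j ^+ 2].  For every scalar [M],
      [\sum_i 'X_i * (M *: s - (n M) *: 'X_i)
         + \sum_i (1 - 'X_i) * (M *: s) = n M *: s - n M *: s = 0],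
    so [M *: s - (n M) *: 'X_i] may be added to the cofactor of ['X_i] and
    [M *: s] to that of [1 - 'X_i].  The affine term does not affect convexity,
    and [M *: s] dominates any polynomial on the cube once [M] is large: the
    Jensen gap [t p(x) + (1 - t) p(y) - p(t x + (1 - t) y)] is bounded in
    absolute value by a multiple of [t (1 - t) |x - y|^2] ([tame_mpoly]), and
    the gap of [s] equals [t (1 - t) |x - y|^2] ([jensen_gap_sqnorm]).

    Adding a quadratic is permitted only when [d - 1 >= 2]; for [d - 1 <= 1]
    all cofactors are affine and [M = 0] works. *)

(** * Degree bounds *)

Section Degree.
Variables (R : realType) (n : nat).
Implicit Types (p q : {mpoly R[n]}) (k : nat).

Lemma degree_leD k p q : degree_le k p -> degree_le k q -> degree_le k (p + q).
Proof.
by move=> hp hq; apply: leq_trans (msizeD_le p q) _; rewrite geq_max; apply/andP.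
Qed.

Lemma degree_leZ k (c : R) p : degree_le k p -> degree_le k (c *: p).
Proof. exact: leq_trans (msizeZ_le p c). Qed.

Lemma degree_le0 k : degree_le k (0 : {mpoly R[n]}).
Proof. by rewrite /degree_le msize0. Qed.

Lemma degree_leC k (c : R) : degree_le k (c%:MP : {mpoly R[n]}).
Proof. by rewrite /degree_le msizeC; case: (c != 0). Qed.

Lemma degree_leX k (m : 'X_{1..n}) :
  (mdeg m <= k)%N -> degree_le k ('X_[m] : {mpoly R[n]}).
Proof. by rewrite /degree_le msizeX ltnS. Qed.

(** A monomial of positive degree is assigned to one variable dividing it. *)
Lemma degree_le_split d p : degree_le d p ->
  exists (c : R) (a : 'I_n -> {mpoly R[n]}),
    (forall i, degree_le d.-1 (a i)) /\ p = c%:MP + \sum_(i < n) 'X_i * a i.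
Proof.
move=> hp; rewrite [p]mpolyE big_seq.
elim/big_ind: _ => [|x y [c1 [a1 [ha1 ->]]] [c2 [a2 [ha2 ->]]]|m hm].
- exists 0, (fun=> 0); split=> [i|]; first exact: degree_le0.
  by rewrite mpolyC0 add0r big1 // => i _; rewrite mulr0.
- exists (c1 + c2), (fun i => a1 i + a2 i).
  split=> [i|]; first exact: degree_leD.
  rewrite mpolyCD addrACA -big_split /=.
  by congr (_ + _); apply: eq_bigr => i _; rewrite mulrDr.
- have [->|m0] := eqVneq m 0%MM.
    exists p@_0, (fun=> 0); split=> [i|]; first exact: degree_le0.
    rewrite mpolyX0 big1 ?addr0; last by move=> i _; rewrite mulr0.
    by rewrite -mul_mpolyC mulr1.
  have [i mi] : exists i, m i != 0%N.
    apply/existsP; apply: contra_neqT m0 => /existsPn h.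
    by apply/mnmP => i; rewrite mnm0E; apply/eqP; rewrite -[_ == _]negbK h.
  have hU : (U_(i) <= m)%MM.
    by apply/mnm_lepP => j; rewrite mnm1E; case: eqP => // <-; rewrite lt0n.
  exists 0, (fun j => if j == i then p@_m *: 'X_[m - U_(i)] else 0); split=> [j|].
    case: eqP => _; last exact: degree_le0.
    apply/degree_leZ/degree_leX.
    have := leq_trans (msize_mdeg_lt hm) hp; rewrite ltnS -{1}(submK hU).
    by rewrite mdegD mdeg1 addn1; case: d {hp}.
  rewrite mpolyC0 add0r (bigD1 i) //= eqxx big1 => [|j /negPf ->]; last first.
    by rewrite mulr0.
  by rewrite addr0 -scalerAr -mpolyXD addmC submK.
Qed.

End Degree.

(** * The Jensen gap *)

Section JensenGap.
Variables (R : realType) (n : nat).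
Implicit Types (p q : {mpoly R[n]}) (x y : 'rV[R]_n) (t M : R).

(** The convex combination giving weight [t] to [x]. *)
Definition mix t x y : 'rV[R]_n := t *: x + (1 - t) *: y.

(** The defect in Jensen's inequality between [x] and [y]; [p] is convex on the
    unit cube when it is nonnegative there. *)
Definition jensen_gap p t x y : R :=
  t * mpoly_fun p x + (1 - t) * mpoly_fun p y - mpoly_fun p (mix t x y).

(** The squared Euclidean distance. *)
Definition sqdist x y : R := \sum_(i < n) (x 0 i - y 0 i) ^+ 2.

(** The squared Euclidean norm, as a polynomial. *)
Definition sqnorm : {mpoly R[n]} := \sum_(i < n) 'X_i ^+ 2.

Lemma sqdist_ge0 x y : 0 <= sqdist x y.
Proof. by apply: sumr_ge0 => i _; exact: sqr_ge0. Qed.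

Lemma mix_unit_cube t x y : 0 <= t <= 1 ->
  unit_cube x -> unit_cube y -> unit_cube (mix t x y).
Proof.
move=> /andP[t0 t1] hx hy i; rewrite /mix !mxE.
by have /andP[? ?] := hx i; have /andP[? ?] := hy i; apply/andP; split; nra.
Qed.

Lemma mpoly_funC (c : R) x : mpoly_fun (c%:MP : {mpoly R[n]}) x = c.
Proof. exact: mevalC. Qed.

Lemma mpoly_funX i x : mpoly_fun ('X_i : {mpoly R[n]}) x = x 0 i.
Proof. exact: mevalXU. Qed.

Lemma mpoly_funD p q x : mpoly_fun (p + q) x = mpoly_fun p x + mpoly_fun q x.
Proof. exact: mevalD. Qed.

Lemma mpoly_funM p q x : mpoly_fun (p * q) x = mpoly_fun p x * mpoly_fun q x.
Proof. exact: mevalM. Qed.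

Lemma mpoly_funZ (c : R) p x : mpoly_fun (c *: p) x = c * mpoly_fun p x.
Proof. exact: mevalZ. Qed.

Lemma jensen_gapD p q t x y :
  jensen_gap (p + q) t x y = jensen_gap p t x y + jensen_gap q t x y.
Proof. by rewrite /jensen_gap !mpoly_funD; ring. Qed.

Lemma jensen_gapZ (c : R) p t x y :
  jensen_gap (c *: p) t x y = c * jensen_gap p t x y.
Proof. by rewrite /jensen_gap !mpoly_funZ; ring. Qed.

Lemma jensen_gapC (c : R) t x y : jensen_gap c%:MP t x y = 0.
Proof. by rewrite /jensen_gap !mpoly_funC; ring. Qed.

Lemma jensen_gapX i t x y : jensen_gap 'X_i t x y = 0.
Proof. by rewrite /jensen_gap !mpoly_funX !mxE; ring. Qed.

Lemma jensen_gap_sum (F : 'I_n -> {mpoly R[n]}) t x y :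
  jensen_gap (\sum_(i < n) F i) t x y = \sum_(i < n) jensen_gap (F i) t x y.
Proof.
apply: (big_morph (fun p => jensen_gap p t x y)) => [p q|].
  exact: jensen_gapD.
by rewrite -mpolyC0 jensen_gapC.
Qed.

Lemma jensen_gap_affine p t x y : degree_le 1 p -> jensen_gap p t x y = 0.
Proof.
move=> /degree_le_split[c [a [ha ->]]].
rewrite jensen_gapD jensen_gapC add0r jensen_gap_sum big1 // => i _.
by rewrite (msize1_polyC (ha i)) mulrC mul_mpolyC jensen_gapZ jensen_gapX mulr0.
Qed.

Lemma jensen_gap_sqnorm t x y :
  jensen_gap sqnorm t x y = t * (1 - t) * sqdist x y.
Proof.
rewrite jensen_gap_sum mulr_sumr; apply: eq_bigr => i _.
by rewrite /jensen_gap !expr2 !mpoly_funM !mpoly_funX !mxE; ring.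
Qed.

Lemma jensen_gap_ge0_convex p :
  (forall t x y, 0 <= t <= 1 -> unit_cube x -> unit_cube y ->
     0 <= jensen_gap p t x y) ->
  convex_on_unit_cube p.
Proof.
move=> h t x y /set_mem hx /set_mem hy.
have := h t%:num x y; rewrite /jensen_gap subr_ge0; apply=> //.
by apply/andP; split.
Qed.

(** * Polynomials are tame on the cube *)

(** [tame M p]: on the unit cube, [M] bounds [p], the square of its Lipschitz
    constant, and its curvature in the sense of the Jensen gap.  The first two
    bounds are there to make the class of tame polynomials stable under
    products. *)
Definition tame M p : Prop :=
  [/\ forall x, unit_cube x -> `|mpoly_fun p x| <= M,
      forall x y, unit_cube x -> unit_cube y ->
        (mpoly_fun p x - mpoly_fun p y) ^+ 2 <= M * sqdist x y
    & forall t x y, 0 <= t <= 1 -> unit_cube x -> unit_cube y ->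
        `|jensen_gap p t x y| <= M * (t * (1 - t) * sqdist x y)].

Lemma onem_mul_sqdist_ge0 t x y : 0 <= t <= 1 -> 0 <= t * (1 - t) * sqdist x y.
Proof.
by case/andP=> t0 t1; rewrite !mulr_ge0 ?subr_ge0 ?sqdist_ge0.
Qed.

Lemma tameW M N p : M <= N -> tame M p -> tame N p.
Proof.
move=> MN [hb hl hg]; split=> [x hx|x y hx hy|t x y ht hx hy].
- exact: le_trans (hb x hx) MN.
- by apply: le_trans (hl x y hx hy) _; apply: ler_wpM2r => //; exact: sqdist_ge0.
- apply: le_trans (hg t x y ht hx hy) _; apply: ler_wpM2r => //.
  exact: onem_mul_sqdist_ge0.
Qed.

Lemma tameC (c : R) : tame `|c| c%:MP.
Proof.
split=> [x _|x y _ _|t x y ht _ _].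
- by rewrite mpoly_funC.
- by rewrite !mpoly_funC subrr expr0n mulr_ge0 ?sqdist_ge0.
- by rewrite jensen_gapC normr0 mulr_ge0 ?onem_mul_sqdist_ge0.
Qed.

Lemma tameX i : tame 1 'X_i.
Proof.
split=> [x hx|x y _ _|t x y ht _ _].
- by rewrite mpoly_funX; have /andP[x0 x1] := hx i; rewrite ger0_norm.
- rewrite !mpoly_funX mul1r /sqdist (bigD1 i) //= lerDl.
  by apply: sumr_ge0 => j _; exact: sqr_ge0.
- by rewrite jensen_gapX normr0 mulr_ge0 ?onem_mul_sqdist_ge0.
Qed.

Lemma tameD M p q : 0 <= M -> tame M p -> tame M q -> tame (4 * M) (p + q).
Proof.
move=> M0 [pb pl pg] [qb ql qg]; split=> [x hx|x y hx hy|t x y ht hx hy].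
- rewrite mpoly_funD; apply: le_trans (ler_normD _ _) _.
  by move: (pb x hx) (qb x hx); lra.
- rewrite !mpoly_funD.
  move: (pl x y hx hy) (ql x y hx hy).
  set a := mpoly_fun p x; set b := mpoly_fun p y.
  set c := mpoly_fun q x; set d := mpoly_fun q y => h1 h2.
  (* (u + v)^2 <= 2 (u^2 + v^2) *)
  by have := sqr_ge0 (a - b - (c - d)); nra.
- rewrite jensen_gapD; apply: le_trans (ler_normD _ _) _.
  have := pg t x y ht hx hy; have := qg t x y ht hx hy.
  have := mulr_ge0 M0 (onem_mul_sqdist_ge0 t x y ht).
  rewrite -mulrA; lra.
Qed.

(** With [z] the convex combination of [x] and [y], the gap of a product is
    [t (1 - t) (p x - p y) (q x - q y)] plus the gaps of [p] and [q] weighted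
    by values of the other factor. *)
Lemma jensen_gapM p q t x y :
  jensen_gap (p * q) t x y =
    t * (1 - t) * ((mpoly_fun p x - mpoly_fun p y) *
                   (mpoly_fun q x - mpoly_fun q y))
    + jensen_gap p t x y * (t * mpoly_fun q x + (1 - t) * mpoly_fun q y)
    + mpoly_fun p (mix t x y) * jensen_gap q t x y.
Proof. by rewrite /jensen_gap !mpoly_funM; ring. Qed.

(** The three terms of the constant come, in order, from the squared increments,
    from the last two terms of [jensen_gapM] and from its first term. *)
Lemma tameM M p q : 0 <= M -> tame M p -> tame M q ->
  tame (4 * M ^+ 3 + 2 * M ^+ 2 + M) (p * q).
Proof.
move=> M0 [pb pl pg] [qb ql qg].
have M2 : 0 <= M ^+ 2 by rewrite exprn_ge0.
have M3 : 0 <= M ^+ 3 by rewrite exprn_ge0.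
split=> [x hx|x y hx hy|t x y ht hx hy].
- rewrite mpoly_funM normrM.
  have : `|mpoly_fun p x| * `|mpoly_fun q x| <= M * M.
    by apply: ler_pM => //; [exact: pb | exact: qb].
  by rewrite -expr2; lra.
- rewrite !mpoly_funM.
  have := pl x y hx hy; have := ql x y hx hy.
  have : mpoly_fun q x ^+ 2 <= M ^+ 2.
    by rewrite -real_normK ?num_real // lerXn2r ?nnegrE // qb.
  have : mpoly_fun p y ^+ 2 <= M ^+ 2.
    by rewrite -real_normK ?num_real // lerXn2r ?nnegrE // pb.
  have S0 := sqdist_ge0 x y.
  move: S0; set S := sqdist x y; set a := mpoly_fun p x; set b := mpoly_fun p y.
  set c := mpoly_fun q x; set d := mpoly_fun q y => S0 hb hc hq hp.
  have MS : 0 <= M * S by rewrite mulr_ge0.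
  have e1 : (a - b) ^+ 2 * c ^+ 2 <= M * S * M ^+ 2.
    by apply: ler_pM => //; exact: sqr_ge0.
  have e2 : b ^+ 2 * (c - d) ^+ 2 <= M ^+ 2 * (M * S).
    by apply: ler_pM => //; exact: sqr_ge0.
  have M2S : 0 <= M ^+ 2 * S by rewrite mulr_ge0.
  (* a c - b d = (a - b) c + b (c - d), and (u + v)^2 <= 2 (u^2 + v^2) *)
  have e3 : (a * c - b * d) ^+ 2 <=
      2 * ((a - b) ^+ 2 * c ^+ 2 + b ^+ 2 * (c - d) ^+ 2).
    rewrite -subr_ge0.
    rewrite [X in 0 <= X](_ : _ = ((a - b) * c - b * (c - d)) ^+ 2); last by ring.
    exact: sqr_ge0.
  apply: le_trans e3 _.
  rewrite [leRHS](_ : _ =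
    2 * (M * S * M ^+ 2 + M ^+ 2 * (M * S)) + 2 * (M ^+ 2 * S) + M * S); last by ring.
  lra.
- rewrite jensen_gapM.
  have T0 := onem_mul_sqdist_ge0 t x y ht.
  have [t0 t1] := andP ht.
  have tt : 0 <= t * (1 - t) by rewrite mulr_ge0 // subr_ge0.
  have h1 : `|(mpoly_fun p x - mpoly_fun p y) * (mpoly_fun q x - mpoly_fun q y)|
      <= M * sqdist x y.
    move: (pl x y hx hy) (ql x y hx hy).
    set u := _ - mpoly_fun p y; set v := _ - mpoly_fun q y => hu hv.
    (* |u v| <= (u^2 + v^2) / 2 *)
    have := sqr_ge0 (u - v); have := sqr_ge0 (u + v).
    by rewrite ler_norml => ? ?; apply/andP; split; lra.
  have h2 : `|t * mpoly_fun q x + (1 - t) * mpoly_fun q y| <= M.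
    apply: le_trans (ler_normD _ _) _; rewrite !normrM (ger0_norm t0).
    have t1' : 0 <= 1 - t by rewrite subr_ge0.
    rewrite (ger0_norm t1').
    have := ler_wpM2l t0 (qb x hx); have := ler_wpM2l t1' (qb y hy); lra.
  have h3 := pb _ (mix_unit_cube t x y ht hx hy).
  have hp := pg t x y ht hx hy; have hq := qg t x y ht hx hy.
  set T := t * (1 - t) * sqdist x y in T0 hp hq *.
  have k1 : `|t * (1 - t) * ((mpoly_fun p x - mpoly_fun p y) *
              (mpoly_fun q x - mpoly_fun q y))| <= M * T.
    by rewrite normrM ger0_norm // /T mulrCA; exact: ler_wpM2l.
  have k2 : `|jensen_gap p t x y *
              (t * mpoly_fun q x + (1 - t) * mpoly_fun q y)| <= M * T * M.
    by rewrite normrM; exact: ler_pM.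
  have k3 : `|mpoly_fun p (mix t x y) * jensen_gap q t x y| <= M * (M * T).
    by rewrite normrM; exact: ler_pM.
  apply: le_trans (ler_normD _ _) _.
  apply: le_trans (lerD (ler_normD _ _) (lexx _)) _.
  have M3T : 0 <= M ^+ 3 * T by rewrite mulr_ge0.
  rewrite [leRHS](_ : _ = 4 * (M ^+ 3 * T) + M * T * M + M * (M * T) + M * T);
    last by ring.
  lra.
Qed.

Lemma tame_common M N p q : tame M p -> tame N q ->
  exists K, [/\ 0 <= K, tame K p & tame K q].
Proof.
move=> hp hq; exists (`|M| + `|N|); split; first by rewrite addr_ge0.
  by apply: tameW hp; rewrite (le_trans (ler_norm M)) // lerDl.
by apply: tameW hq; rewrite (le_trans (ler_norm N)) // lerDr.
Qed.

Lemma tame_mpoly p : exists M, tame M p.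
Proof.
have tD q r : (exists M, tame M q) -> (exists M, tame M r) ->
    exists M, tame M (q + r).
  move=> [M hM] [N hN]; have [K [K0 ? ?]] := tame_common _ _ _ _ hM hN.
  by eexists; exact: tameD K0 _ _.
have tM q r : (exists M, tame M q) -> (exists M, tame M r) ->
    exists M, tame M (q * r).
  move=> [M hM] [N hN]; have [K [K0 ? ?]] := tame_common _ _ _ _ hM hN.
  by eexists; exact: tameM K0 _ _.
have tC c : exists M, tame M c%:MP by eexists; exact: tameC.
rewrite [p]mpolyE; elim/big_ind: _ => // [|m _]; first by rewrite -mpolyC0.
rewrite -mul_mpolyC; apply: (tM) => //; rewrite mpolyXE_id.
elim/big_ind: _ => // [|i _]; first by rewrite -mpolyC1.
elim: (m i) => [|k IH]; first by rewrite expr0 -mpolyC1.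
by rewrite exprS; apply: (tM) => //; exists 1; exact: tameX.
Qed.

Lemma degree_le_sqnorm k : (2 <= k)%N -> degree_le k sqnorm.
Proof.
move=> k2; rewrite /sqnorm; elim/big_ind: _ => [|x y|i _].
- exact: degree_le0.
- exact: degree_leD.
- by rewrite mpolyXn; apply: degree_leX; rewrite mdegMn mdeg1 mul1n.
Qed.

(** A single multiple of the squared norm, of admissible degree, convexifies a
    whole finite family.  The condition on [M] says that no quadratic is used
    when the degree bound [k] does not allow it. *)
Lemma convexifying_multiplier k (a : 'I_n -> {mpoly R[n]}) :
  (forall i, degree_le k (a i)) ->
  exists2 M, 0 <= M /\ (M = 0 \/ (2 <= k)%N) &
    forall i t x y, 0 <= t <= 1 -> unit_cube x -> unit_cube y ->
      0 <= jensen_gap (a i + M *: sqnorm) t x y.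
Proof.
move=> ha; have [k1|k2] := leqP k 1.
  exists 0; first by split=> //; left.
  move=> i t x y _ _ _; rewrite scale0r addr0 jensen_gap_affine //.
  exact: leq_trans (ha i) _.
have /choice[N hN] i := tame_mpoly (a i).
exists (\sum_(i < n) `|N i|); first by split; [exact: sumr_ge0 | right].
move=> i t x y ht hx hy.
have NM : N i <= \sum_(j < n) `|N j|.
  rewrite (bigD1 i) //=; apply: le_trans (ler_norm _) _.
  by rewrite lerDl sumr_ge0.
have [_ _ /(_ t x y ht hx hy)] := tameW _ _ _ NM (hN i).
rewrite ler_norml jensen_gapD jensen_gapZ jensen_gap_sqnorm => /andP[+ _].
by rewrite -subr_ge0 opprK.
Qed.

End JensenGap.

(** * The representation *)

Theorem theorem8 (R : realType) (n d : nat) (n_ge1 : (1 <= n)%N)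
    (d_ge1 : (1 <= d)%N) (p : {mpoly R[n]}) (deg_p : degree_le d p) :
  exists P Q : 'I_n -> {mpoly R[n]},
    [/\ forall i : 'I_n, degree_le d.-1 (P i) /\ convex_on_unit_cube (P i),
        forall i : 'I_n, degree_le d.-1 (Q i) /\ convex_on_unit_cube (Q i)
      & p = \sum_(i < n) 'X_i * P i + \sum_(i < n) (1 - 'X_i) * Q i].
Proof.
have [c [a [ha ->]]] := degree_le_split _ _ _ _ deg_p.
have [M [M0 hM] convM] := convexifying_multiplier _ _ _ _ ha.
have degM : degree_le d.-1 (M *: sqnorm R n).
  case: hM => [->|d2]; first by rewrite scale0r degree_le0.
  exact/degree_leZ/degree_le_sqnorm.
have degX i : degree_le d.-1 (- (n%:R * M) *: 'X_i : {mpoly R[n]}).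
  case: hM => [->|d2]; first by rewrite mulr0 oppr0 scale0r degree_le0.
  by apply/degree_leZ/degree_leX; rewrite mdeg1; exact: ltnW.
pose c' : R := c / n%:R.
exists (fun i => a i + M *: sqnorm R n + (- (n%:R * M) *: 'X_i + c'%:MP)).
exists (fun=> M *: sqnorm R n + c'%:MP); split=> [i|i|].
- split; first by rewrite !degree_leD ?degree_leC.
  apply: jensen_gap_ge0_convex => t x y ht hx hy.
  rewrite jensen_gapD (jensen_gapD _ _ (_ *: 'X_i)) jensen_gapZ jensen_gapX.
  by rewrite jensen_gapC mulr0 !addr0; exact: convM.
- split; first by rewrite degree_leD ?degree_leC.
  apply: jensen_gap_ge0_convex => t x y ht _ _.
  rewrite jensen_gapD jensen_gapC addr0 jensen_gapZ jensen_gap_sqnorm.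
  by rewrite mulr_ge0 ?onem_mul_sqdist_ge0.
- have -> : c%:MP = \sum_(i < n) c'%:MP :> {mpoly R[n]}.
    rewrite sumr_const card_ord -mpolyCMn /c' -[_ *+ n]mulr_natr divfK //.
    by rewrite pnatr_eq0 -lt0n.
  have sum0 : \sum_(i < n) (M *: sqnorm R n - (n%:R * M) *: 'X_i ^+ 2) = 0.
    rewrite sumrB sumr_const card_ord -scaler_sumr -/(sqnorm R n).
    by rewrite -scaler_nat scalerA subrr.
  rewrite -big_split -big_split -[LHS]addr0 -[X in _ + X]sum0 -big_split /=.
  apply: eq_bigr => i _; rewrite -!mul_mpolyC mpolyCN; ring.
Qed.
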